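(* For every integer $n\ge 3$ let $$\tau(n)=\min\{t(G)+i(G) : G \text{ is an oriented graph on } n \text{ vertices}\}.$$ The sequence $\tau(n)$ converges and $\tau:=\lim_{n\to\infty}\tau(n)=\frac19$. That is, every $n$-vertex oriented graph $G$ satisfies $t(G)+i(G)\ge \frac19-o_n(1)$, and this bound is tight.
   Context: An oriented graph is a directed graph with no loops and no multiple (parallel or anti-parallel) edges. For an oriented graph $G$, $t(G)$ (respectively $i(G)$) denotes the probability that a uniformly random set of $3$ vertices of $G$ induces a transitive triangle (respectively an independent set, i.e. spans no edges). *)

(* Defs.v *)
From HB Require Import structures.
From mathcomp Require Import all_boot all_order all_algebra.
From mathcomp Require Import all_classical all_reals all_analysis.

Set Implicit Arguments.
Unset Strict Implicit.
Unset Printing Implicit Defensive.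

Import Order.TTheory GRing.Theory Num.Theory.
Import numFieldNormedType.Exports.
Local Open Scope ring_scope.

(* A digraph on V is its set of arcs, so parallel arcs cannot occur. *)
Definition oriented (V : finType) (E : {set V * V}) : bool :=
  [forall u, (u, u) \notin E] &&
  [forall u, forall v, ~~ (((u, v) \in E) && ((v, u) \in E))].

Definition triples (V : finType) : {set {set V}} :=
  [set S : {set V} | #|S| == 3%N].

(* For a triple S of an oriented graph, the three arcs listed here are the only
   ones that S can span, so this says that the subgraph induced by S is a
   transitive triangle. *)
Definition transitive_triangle (V : finType) (E : {set V * V}) (S : {set V}) :
    bool :=
  [exists x, exists y, exists z,
     [&& S == [set x; y; z], (x, y) \in E, (y, z) \in E & (x, z) \in E]].

Definition independent (V : finType) (E : {set V * V}) (S : {set V}) : bool :=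
  [forall x in S, forall y in S, (x, y) \notin E].

Definition triple_prob (R : realType) (V : finType) (P : pred {set V}) : R :=
  #|[set S in triples V | P S]|%:R / #|triples V|%:R.

Definition t_density (R : realType) (V : finType) (E : {set V * V}) : R :=
  triple_prob R (transitive_triangle E).

Definition i_density (R : realType) (V : finType) (E : {set V * V}) : R :=
  triple_prob R (independent E).

(* The arcless graph set0 only witnesses that there is something to minimize
   over. For n < 3 there are no triples and the value is 0 / 0 = 0. *)
Definition tau (R : realType) (n : nat) : R :=
  let f (E : {set 'I_n * 'I_n}) := t_density R E + i_density R E in
  f [arg min_(E < finset.set0 | oriented E) f E]%O.

Lemma oriented0 (V : finType) : oriented (finset.set0 : {set V * V}).
Proof.
apply/andP; split; apply/forallP => u; first by rewrite inE.
by apply/forallP => v; rewrite inE.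
Qed.

Lemma tau_attained (R : realType) (n : nat) :
  exists2 E : {set 'I_n * 'I_n},
    oriented E & tau R n = t_density R E + i_density R E.
Proof.
rewrite /tau /=; case: arg_minP => [|E oE _]; first exact: oriented0.
by exists E.
Qed.

Lemma tau_le (R : realType) (n : nat) (E : {set 'I_n * 'I_n}) :
  oriented E -> tau R n <= t_density R E + i_density R E.
Proof.
move=> oE; rewrite /tau /=; case: arg_minP => [|F _ minF]; first exact: oriented0.
exact: minF.
Qed.

(* Main.v *)
(* The blow-up of the cyclic triangle with parts as equal as possible has no
   transitive triangle, and its independent triples are those inside a part, so
   t + i is at most 1/9. For the lower bound, sample four vertices
   independently and uniformly, with repetition, reading a repeated vertex as
   a nonadjacent pair. For fixed roots x, y, an expression
   c f(x, y, z) f(x, y, w) with c >= 0 averages over z, w to c times a square.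
   A sum of eight such expressions (a flag algebra certificate, with mean zero
   on the blow-up), averaged over the orderings of the four vertices, is at most
   72 times the excess over 1/9 of the proportion of transitive or independent
   triples, on each of the 729 labelled oriented graphs on four vertices.
   Sampling with repetition changes the densities by O(1/n) only. *)
Require Import Defs.
From HB Require Import structures.
From mathcomp Require Import all_boot all_order all_algebra.
From mathcomp Require Import all_classical all_reals all_analysis.
From mathcomp Require Import zify ring lra.

Set Implicit Arguments.
Unset Strict Implicit.
Unset Printing Implicit Defensive.

Import Order.TTheory GRing.Theory Num.Theory.
Import numFieldNormedType.Exports.
Local Open Scope classical_set_scope.
Local Open Scope ring_scope.

(** * Symmetrization of sums over four vertices *)

Definition sum4 (V : finType) (g : V -> V -> V -> V -> int) : int :=
  \sum_x \sum_y \sum_z \sum_w g x y z w.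

Lemma sum4D (V : finType) (g h : V -> V -> V -> V -> int) :
  sum4 (fun x y z w => g x y z w + h x y z w) = sum4 g + sum4 h.
Proof.
by rewrite /sum4; do 4 (rewrite -big_split /=; apply: eq_bigr => ? _).
Qed.

Lemma sum4_ge0 (V : finType) (g : V -> V -> V -> V -> int) :
  (forall x y z w, 0 <= g x y z w) -> 0 <= sum4 g.
Proof. by move=> g_ge0; do 4 (apply: sumr_ge0 => ? _); exact: g_ge0. Qed.

Lemma sum4_swap12 (V : finType) (g : V -> V -> V -> V -> int) :
  sum4 (fun x y => g y x) = sum4 g.
Proof. exact: exchange_big. Qed.

Lemma sum4_swap23 (V : finType) (g : V -> V -> V -> V -> int) :
  sum4 (fun x y z => g x z y) = sum4 g.
Proof. by apply: eq_bigr => x _; exact: exchange_big. Qed.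

Lemma sum4_swap34 (V : finType) (g : V -> V -> V -> V -> int) :
  sum4 (fun x y z w => g x y w z) = sum4 g.
Proof. by do 2 (apply: eq_bigr => ? _); exact: exchange_big. Qed.

Lemma sum4_rot3 (V : finType) (g : V -> V -> V -> V -> int) :
  sum4 (fun x y z => g y z x) = sum4 g.
Proof. by rewrite (sum4_swap12 (fun x y z => g x z y)) sum4_swap23. Qed.

Lemma sum4_rot4 (V : finType) (g : V -> V -> V -> V -> int) :
  sum4 (fun x y z w => g y z w x) = sum4 g.
Proof. by rewrite (sum4_rot3 (fun x y z w => g x y w z)) sum4_swap34. Qed.

(* [S_4] is the product of the cyclic groups generated by [(1 2)], [(1 2 3)]
   and [(1 2 3 4)]. *)
Definition sym2 (V : Type) (g : V -> V -> V -> V -> int) x y z w :=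
  g x y z w + g y x z w.
Definition sym3 (V : Type) (g : V -> V -> V -> V -> int) x y z w :=
  g x y z w + g y z x w + g z x y w.
Definition sym4 (V : Type) (g : V -> V -> V -> V -> int) x y z w :=
  g x y z w + g y z w x + g z w x y + g w x y z.

Lemma sum4_sym (V : finType) (g : V -> V -> V -> V -> int) :
  sum4 (sym4 (sym3 (sym2 g))) = sum4 g *+ 24.
Proof.
have s2 h : sum4 (sym2 h) = sum4 h *+ 2 :> int.
  by rewrite sum4D sum4_swap12 mulr2n.
have s3 h : sum4 (sym3 h) = sum4 h *+ 3 :> int.
  have e1 := sum4_rot3 h; have e2 := sum4_rot3 (fun x y z => h y z x).
  by rewrite !sum4D e2 e1; ring.
have s4 h : sum4 (sym4 h) = sum4 h *+ 4 :> int.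
  have e1 := sum4_rot4 h; have e2 := sum4_rot4 (fun x y z w => h y z w x).
  have e3 := sum4_rot4 (fun x y z w => h z w x y).
  by rewrite !sum4D e3 e2 e1; ring.
by rewrite s4 s3 s2 -!mulrnA.
Qed.

(** * The certificate and its verification *)

(* [Some true] is an arc from [x] to [y], [Some false] an arc from [y] to [x]. *)
Definition rel_of (V : finType) (E : {set V * V}) (x y : V) : option bool :=
  if (x, y) \in E then Some true else
  if (y, x) \in E then Some false else None.

Lemma rel_ofC (V : finType) (E : {set V * V}) x y :
  oriented E -> rel_of E y x = omap negb (rel_of E x y).
Proof.
case/andP=> _ /forallP /(_ x) /forallP /(_ y); rewrite /rel_of.
by case: (_ \in E); case: (_ \in E).
Qed.

(* For [p], [q], [r] the relations of [x] to [y], [y] to [z] and [x] to [z]: the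
   triple is independent, or a triangle that is not cyclic. *)
Definition good (p q r : option bool) : bool :=
  match p, q, r with
  | None, None, None => true
  | Some a, Some b, Some c => ~~ ((a == b) && (c != a))
  | _, _, _ => false
  end.

Definition chi (a b p q : option bool) : int := ((p == a) && (q == b))%:R.

Notation n_ := (None : option bool).
Notation o_ := (Some true : option bool).
Notation i_ := (Some false : option bool).

(* Weighted linear forms in the position (relation from [x], relation from [y])
   of a vertex with respect to roots [x], [y]; the weights and coefficients are
   a rounded solution of a semidefinite program. Each form has mean zero over
   the limit of the balanced blow-ups of the cyclic triangle, where the bound
   is attained. *)
Definition forms_nonadjacent :
    seq (int * (option bool -> option bool -> int)) :=
  let nn := chi n_ n_ in let no := chi n_ o_ in let ni := chi n_ i_ in
  let on := chi o_ n_ in let oo := chi o_ o_ in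
  let in_ := chi i_ n_ in let ii := chi i_ i_ in
  [:: (16, fun p q => 2 * nn p q - oo p q - ii p q);
      (24, fun p q => no p q + on p q - ni p q - in_ p q);
      (36, fun p q => no p q - on p q + ni p q - in_ p q)].

Definition forms_arc : seq (int * (option bool -> option bool -> int)) :=
  let nn := chi n_ n_ in let no := chi n_ o_ in let ni := chi n_ i_ in
  let on := chi o_ n_ in let oo := chi o_ o_ in
  let in_ := chi i_ n_ in let io := chi i_ o_ in let ii := chi i_ i_ in
  [:: (32, fun p q => 2 * io p q - ni p q - on p q - nn p q + no p q + in_ p q);
      (1, fun p q =>
            8 * nn p q - 5 * (no p q + in_ p q) - 9 * (oo p q + ii p q));
      (25, fun p q => no p q + in_ p q - 2 * (oo p q + ii p q));
      (108, fun p q => no p q - in_ p q);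
      (72, fun p q => ni p q - on p q)].

(* The ordered roots are chosen so that an arc goes from the first to the
   second, hence no forms for [Some false]. *)
Definition forms (s : option bool) :=
  match s with None => forms_nonadjacent | Some true => forms_arc
             | Some false => [::] end.

Definition squares (V : Type) (r : V -> V -> option bool) (x y z w : V) : int :=
  \sum_(f <- forms (r x y)) f.1 * (f.2 (r x z) (r y z) * f.2 (r x w) (r y w)).

(** Here [8] is [72 / 9]. Only one triple is tested; symmetrization brings in the other three. *)
Definition gap (V : Type) (r : V -> V -> option bool) (x y z w : V) : int :=
  72 * (good (r x y) (r y z) (r x z))%:R - 8 - squares r x y z w.

Lemma sum4_squares_ge0 (V : finType) (r : V -> V -> option bool) :
  0 <= sum4 (squares r).
Proof.
apply: sumr_ge0 => x _; apply: sumr_ge0 => y _.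
under eq_bigr => z _ do rewrite exchange_big.
rewrite exchange_big /= big_seq sumr_ge0 // => f f_in.
under eq_bigr => z _ do (rewrite -mulr_sumr -mulr_sumr).
rewrite -mulr_sumr mulr_ge0 //.
  move: f_in; case: (r x y) => [[]|]; rewrite // !inE;
  by repeat (case/orP => [/eqP -> //|]); move/eqP ->.
rewrite -mulr_suml; exact: sqr_ge0.
Qed.

Lemma sym_gap_ge0 (V : Type) (r : V -> V -> option bool) (x y z w : V) :
  (forall u v, r v u = omap negb (r u v)) ->
  0 <= sym4 (sym3 (sym2 (gap r))) x y z w.
Proof.
move=> rC; rewrite /sym4 /sym3 /sym2 /gap /squares.
(* Reading each pair in one direction leaves six free relations, hence 3^6 = 729 cases. *)
rewrite ![r y x]rC ![r z x]rC ![r w x]rC ![r z y]rC ![r w y]rC ![r w z]rC.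
move: (r x y) (r x z) (r x w) (r y z) (r y w) (r z w).
(* Unlocking the big operator lets the sum over [forms] compute. *)
rewrite unlock.
by do 6 case=> [[]|]; vm_compute.
Qed.

Definition good_triple (V : finType) (E : {set V * V}) (x y z : V) :=
  good (rel_of E x y) (rel_of E y z) (rel_of E x z).

Lemma good_triple_bound (V : finType) (E : {set V * V}) : oriented E ->
  (#|V| ^ 3 <= 9 * \sum_x \sum_y \sum_z good_triple E x y z)%N.
Proof.
move=> oE; have [->|V_gt0] := posnP #|V|; first by rewrite exp0n.
set r := rel_of E.
have gap_ge0 : 0 <= sum4 (gap r).
  rewrite -(@pmulrn_lge0 _ _ 24) // -sum4_sym.
  by apply: sum4_ge0 => x y z w; apply: sym_gap_ge0 => u v; exact: rel_ofC.
pose S := (\sum_x \sum_y \sum_z good_triple E x y z)%N.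
(* Adding [squares] back cancels it in [gap]; the rest does not depend on [w], whence the factor
   [#|V|]. *)
have gapE : sum4 (gap r) + sum4 (squares r) =
    #|V|%:R * (72 * S%:R - 8 * #|V|%:R ^+ 3).
  have lin (a b : int) (f : V -> int) :
      \sum_v (a * f v - b) = a * (\sum_v f v) - b * #|V|%:R.
    by rewrite sumrB -mulr_sumr sumr_const mulr_natr.
  transitivity (\sum_x \sum_y \sum_z
      (72 * #|V|%:R * (good_triple E x y z)%:R - 8 * #|V|%:R) : int).
    rewrite -sum4D; do 3 (apply: eq_bigr => ? _).
    under eq_bigr do rewrite subrK.
    by rewrite sumr_const -mulr_natr; ring.
  under eq_bigr do (under eq_bigr do rewrite lin; rewrite lin).
  rewrite lin /S natr_sum.
  under [in RHS]eq_bigr do rewrite natr_sum.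
  under [in RHS]eq_bigr do under eq_bigr do rewrite natr_sum.
  by set T := \sum_x _; ring.
have := addr_ge0 gap_ge0 (sum4_squares_ge0 r).
rewrite gapE pmulr_rge0 ?ltr0n // -/S; lia.
Qed.

(** * From ordered triples to three-element sets *)

Lemma sum_3tuple (V : finType) (F : V -> V -> V -> nat) :
  (\sum_x \sum_y \sum_z F x y z =
   \sum_(t : 3.-tuple V) F (tnth t 0%R) (tnth t 1%R) (tnth t 2%:R))%N.
Proof.
rewrite pair_big pair_big /=.
pose h (t : 3.-tuple V) := ((tnth t 0, tnth t 1), tnth t 2%:R).
rewrite (reindex h) //=.
exists (fun p => [tuple p.1.1; p.1.2; p.2]) => [t _|[[x y] z] _] //.
apply: eq_from_tnth => -[[|[|[|]]] // lt_i3]; rewrite (tnth_nth (tnth t 0)) /=;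
  by congr (tnth t _); apply: val_inj.
Qed.

(** Group the injective tuples by underlying set: each set has [k]! orderings. *)
Lemma card_tuples_of_sets (V : finType) (k : nat) (Q : {set {set V}}) :
  (forall S, S \in Q -> #|S| = k) ->
  #|[set t : k.-tuple V | uniq t & [set x in t] \in Q]| = (#|Q| * k`!)%N.
Proof.
move=> cardQ; rewrite -sum1_card.
rewrite (partition_big (fun t : k.-tuple V => [set x in t]%SET) (mem Q)) /=;
  last by move=> t; rewrite inE => /andP[].
rewrite -sum_nat_const; apply: eq_bigr => S SQ.
rewrite -[in RHS](cardQ S SQ) -ffactnn -card_uniq_tuples (cardQ S SQ) sum1_card.
apply: eq_card => t; rewrite unfold_in /= !inE.
apply/idP/idP => [/andP[/andP[ut _] /eqP St]|/andP[At ut]].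
  rewrite ut andbT; apply/allP => x xt.
  by suff: x \in [set y in t]%SET; [rewrite St | rewrite inE].
have St : [set x in t]%SET = S.
  apply/eqP; rewrite eqEcard cardsE (card_uniqP ut) size_tuple (cardQ S SQ).
  rewrite leqnn andbT.
  by apply/fintype.subsetP => x; rewrite inE => /(allP At).
by rewrite St SQ ut eqxx.
Qed.

Definition tri_sets (V : finType) (E : {set V * V}) : {set {set V}} :=
  [set S in triples V | transitive_triangle E S || independent E S]%SET.

Lemma good_tri_sets (V : finType) (E : {set V * V}) (x y z : V) :
  oriented E -> uniq [:: x; y; z] -> good_triple E x y z ->
  [set:: [:: x; y; z]]%SET \in tri_sets E.
Proof.
move=> oE u3; rewrite inE inE cardsE (card_uniqP u3) eqxx /=.
have -> : [set:: [:: x; y; z]]%SET = [set x; y; z]%SET.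
  by apply/setP => v; rewrite !inE orbA.
have trans a b c :
    (forall v, [|| v == x, v == y | v == z] = [|| v == a, v == b | v == c]) ->
    (a, b) \in E -> (b, c) \in E -> (a, c) \in E ->
    transitive_triangle E [set x; y; z]%SET.
  move=> eS ab bc ac; apply/existsP; exists a; apply/existsP; exists b.
  apply/existsP; exists c; rewrite ab bc ac !andbT.
  by apply/eqP/setP => v; rewrite !inE -!orbA.
have perm3 v : [/\ [|| v == x, v == y | v == z] = [|| v == x, v == z | v == y],
    [|| v == x, v == y | v == z] = [|| v == y, v == x | v == z],
    [|| v == x, v == y | v == z] = [|| v == y, v == z | v == x],
    [|| v == x, v == y | v == z] = [|| v == z, v == x | v == y]
  & [|| v == x, v == y | v == z] = [|| v == z, v == y | v == x]].
  by case: (v == x); case: (v == y); case: (v == z).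
have loops v : (v, v) \notin E by case/andP: oE => /forallP /(_ v).
rewrite /good_triple /rel_of.
(* A surviving case is transitive in one of the six vertex orders, or has no arcs; then [loops]
   settles the pairs with [a = b]. *)
case: (boolP ((x, y) \in E)) => xy; case: (boolP ((y, x) \in E)) => yx;
case: (boolP ((y, z) \in E)) => yz; case: (boolP ((z, y) \in E)) => zy;
case: (boolP ((x, z) \in E)) => xz; case: (boolP ((z, x) \in E)) => zx //= _;
apply/orP; first
  [ left; first [ by apply: (trans x y z) => // v; case: (perm3 v)
    | by apply: (trans x z y) => // v; case: (perm3 v)
    | by apply: (trans y x z) => // v; case: (perm3 v)
    | by apply: (trans y z x) => // v; case: (perm3 v)
    | by apply: (trans z x y) => // v; case: (perm3 v)
    | by apply: (trans z y x) => // v; case: (perm3 v) ]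
  | right; apply/forallP => a; apply/implyP; rewrite !inE => aS;
    apply/forallP => b; apply/implyP; rewrite !inE => bS;
    by case/orP: aS => [/orP[]|] /eqP ->; case/orP: bS => [/orP[]|] /eqP -> ].
Qed.

Lemma card_set_sum (T : finType) (P : pred T) :
  #|[set x | P x]%SET| = (\sum_x P x)%N.
Proof. by rewrite -sum1dep_card big_mkcond; apply: eq_bigr => x _; case: P. Qed.

(** Tuples with a repeated vertex are all conceded as good; the other good ones are orderings, six
    each, of sets in [tri_sets E]. *)
Lemma tri_sets_bound (V : finType) (E : {set V * V}) : oriented E ->
  (#|V| ^ 3 <= 9 * (#|V| ^ 3 - #|V| ^_ 3 + 6 * #|tri_sets E|))%N.
Proof.
move=> oE; apply: leq_trans (good_triple_bound oE) _; rewrite leq_mul2l /=.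
rewrite sum_3tuple.
have uniqE : #|[set t : 3.-tuple V | uniq t]%SET| = #|V| ^_ 3.
  rewrite -(@card_uniq_tuples V 3 predT); apply: eq_card => t.
  by rewrite !inE all_predT.
have -> : (#|V| ^ 3 - #|V| ^_ 3 = #|[set t : 3.-tuple V | ~~ uniq t]%SET|)%N.
  rewrite -card_tuple -uniqE -(cardC [set t : 3.-tuple V | uniq t]%SET) addKn.
  by apply: eq_card => t; rewrite !inE.
have cardQ S : S \in tri_sets E -> #|S| = 3%N.
  by rewrite !inE => /andP[/eqP].
rewrite [X in (_ + X)%N]mulnC -(card_tuples_of_sets cardQ).
rewrite !card_set_sum -big_split /=.
apply: leq_sum => -[[|x [|y [|z []]]] // lt3] _; rewrite !(tnth_nth x).
have [u3|_] := boolP (uniq (Tuple lt3)); last by case: good_triple.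
have [gxyz|//] := boolP (good_triple _ _ _ _).
by have /= -> := good_tri_sets oE u3 gxyz.
Qed.

Lemma card_triples (V : finType) : (#|triples V| * 6 = #|V| ^_ 3)%N.
Proof.
by rewrite -bin_ffact -card_draws.
Qed.

Lemma density_lower (R : realType) (n : nat) (E : {set 'I_n * 'I_n}) :
  (3 <= n)%N -> oriented E ->
  1 / 9 - 12 / n%:R <= t_density R E + i_density R E.
Proof.
move: n E => [|[|[|m]]] // E _ oE.
have := tri_sets_bound oE; have := card_triples 'I_m.+3.
rewrite card_ord !ffactnS ffactn0 /= muln1 => cardT boundQ.
have leQ : (#|tri_sets E| <=
     #|[set S in triples 'I_m.+3 | transitive_triangle E S]%SET|
     + #|[set S in triples 'I_m.+3 | independent E S]%SET|)%N.
  rewrite -cardsUI; apply: leq_trans (leq_addr _ _).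
  apply: subset_leq_card; apply/fintype.subsetP => S.
  by rewrite !inE -andb_orr.
rewrite /t_density /i_density /triple_prob -mulrDl -natrD.
move: leQ; set T := #|triples _| in cardT *; set q := #|_| in boundQ *.
set s := (_ + _)%N => leqs.
have T_gt0 : 0 < T%:R :> R by rewrite ltr0n; lia.
have M_ge0 : 0 <= m%:R :> R by [].
have TE : T%:R * 6 = (m%:R + 3) * ((m%:R + 2) * (m%:R + 1)) :> R.
  by rewrite natr1 -!natrD -!natrM cardT !addnS !addn0.
have boundS :
    (m%:R + 3) ^+ 3 <= 9 * ((m%:R + 3) ^+ 3 - T%:R * 6 + 6 * s%:R) :> R.
  (* The truncated subtraction is moved across before casting to [R]. *)
  have : (m.+3 ^ 3 + 9 * (T * 6) <= 9 * (m.+3 ^ 3 + 6 * s))%N.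
    by rewrite cardT; nia.
  have nE : m.+3%:R = m%:R + 3 :> R by rewrite -natrD addn3.
  rewrite -(ler_nat R) !(natrX, natrD, natrM) nE; lra.
rewrite ler_pdivlMr //.
rewrite (_ : m.+3%:R = m%:R + 3); last by rewrite -natrD addn3.
move: TE boundS M_ge0; move: (m%:R : R) (T%:R : R) (s%:R : R) => M t S TE BS M0.
(* With n = M + 3, repeated vertices cost at most 4(3n^2 - 2n)/27, which is below 2(n - 1)(n - 2) =
   12t/n for n >= 3. *)
have -> : (1 / 9 - 12 / (M + 3)) * t = t / 9 - 2 * ((M + 2) * (M + 1)).
  have -> : t = (M + 3) * ((M + 2) * (M + 1)) / 6 by rewrite -TE mulfK.
  by field; apply: lt0r_neq0; lra.
nra.
Qed.

(** * Upper bound: the cyclic triangle blown up along residues mod 3 *)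

Definition blowup (n : nat) : {set 'I_n * 'I_n} :=
  [set p : 'I_n * 'I_n | p.2 %% 3 == p.1.+1 %% 3]%SET%N.

Lemma oriented_blowup (n : nat) : oriented (blowup n).
Proof.
apply/andP; split; apply/forallP => u; rewrite ?inE /=; first by lia.
by apply/forallP => v; rewrite !inE /=; lia.
Qed.

(** Arcs raise the residue by 1, so a path of two arcs raises it by 2 and no arc joins its ends. *)
Lemma blowup_transitive (n : nat) (S : {set 'I_n}) :
  transitive_triangle (blowup n) S = false.
Proof.
apply/negbTE/existsP => -[x /existsP[y /existsP[z /and4P[_]]]].
by rewrite !inE /=; lia.
Qed.

Definition part (n : nat) (j : 'I_3) : {set 'I_n} :=
  [set i : 'I_n | i %% 3 == j]%SET%N.

(** The quotient by 3 is injective on a residue class, with values below n/3 rounded up. *)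
Lemma card_part (n : nat) (j : 'I_3) : (3 * #|part n j| <= n + 2)%N.
Proof.
have [->|n_gt0] := posnP n; first by rewrite eq_card0 // => -[].
suff: (#|part n j| <= (n + 2) %/ 3)%N by lia.
have lt3 (i : 'I_n) : (i %/ 3 < (n + 2) %/ 3)%N by have := ltn_ord i; lia.
rewrite -[leqRHS]card_ord.
apply: (@leq_card_in _ _ (fun i : 'I_n => Ordinal (lt3 i))).
move=> a b; rewrite !inE => /eqP aj /eqP bj [ab]; apply: val_inj => /=; lia.
Qed.

Lemma blowup_independent (n : nat) (S : {set 'I_n}) (x : 'I_n) :
  x \in S -> independent (blowup n) S -> S \subset part n (inord (x %% 3)).
Proof.
move=> xS /forallP ind; apply/fintype.subsetP => y yS.
have arc a b : a \in S -> b \in S -> (b %% 3 != a.+1 %% 3)%N.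
  move=> aS bS; have /implyP /(_ aS) /forallP /(_ b) /implyP /(_ bS) := ind a.
  by rewrite inE.
have := arc x y xS yS; have := arc y x yS xS.
by rewrite inE inordK ?ltn_mod //; lia.
Qed.

(** Rounding part sizes up costs nothing: 3k(3k - 3)(3k - 6) <= (3k - 2)(3k - 3)(3k - 4), and 3k - 2
    <= n. *)
Lemma leq_ffact3 (k n : nat) :
  (3 * k <= n + 2)%N -> (27 * k ^_ 3 <= n ^_ 3)%N.
Proof.
case: k n => [|[|[|k]]] [|[|[|n]]]; try by rewrite ?muln0 //; try lia.
rewrite !ffactnS !ffactn0 /= !muln1 => le3k.
have : ((3 * k + 7) * ((3 * k + 6) * (3 * k + 5)) <= n.+3 * (n.+2 * n.+1))%N.
  by rewrite !leq_mul //; lia.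
by apply: leq_trans; nia.
Qed.

Lemma card_blowup_independent (n : nat) :
  (9 * (#|[set S in triples 'I_n | independent (blowup n) S]%SET| * 6)
    <= n ^_ 3)%N.
Proof.
set I := [set S in _ | _]%SET.
have leI : (#|I| <= \sum_(j < 3) 'C(#|part n j|, 3))%N.
  under eq_bigr do rewrite -cards_draws card_set_sum.
  rewrite exchange_big card_set_sum; apply: leq_sum => S _.
  case: (boolP (_ && _)) => //; rewrite inE => /andP[cardS indS].
  have [x xS] : exists x, x \in S by apply/card_gt0P; rewrite (eqP cardS).
  rewrite (bigD1 (inord (x %% 3))) //= cardS.
  by rewrite (blowup_independent xS indS).
(* Each of the three parts holds at most 1/27 of all triples. *)
have leC (j : 'I_3) : (27 * ('C(#|part n j|, 3) * 6) <= n ^_ 3)%N.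
  by rewrite (bin_ffact _ 3) leq_ffact3 ?card_part.
move: leI; rewrite !big_ord_recl big_ord0.
have := leC ord0; have := leC (lift ord0 ord0).
have := leC (lift ord0 (lift ord0 ord0)).
lia.
Qed.

Lemma blowup_density (R : realType) (n : nat) :
  t_density R (blowup n) + i_density R (blowup n) <= 1 / 9.
Proof.
have -> : t_density R (blowup n) = 0.
  rewrite /t_density /triple_prob eq_card0 ?mul0r // => S.
  by rewrite !inE blowup_transitive andbF.
rewrite add0r /i_density /triple_prob.
have [->|T_gt0] := posnP #|triples 'I_n|; first by rewrite invr0 mulr0 divr_ge0.
have := card_blowup_independent n; have := card_triples 'I_n.
rewrite card_ord => <-; rewrite !mulnA leq_pmul2r // => le9.
rewrite ler_pdivrMr ?ltr0n //.
move: le9; rewrite -(ler_nat R) natrM; lra.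
Qed.

Theorem theorem1p2 (R : realType) :
  [/\ tau R n @[n --> \oo] --> (1 / 9 : R),
      (forall eps : R, 0 < eps -> \forall n \near \oo,
         forall E : {set 'I_n * 'I_n}, oriented E ->
           1 / 9 - eps <= t_density R E + i_density R E)
    & (forall eps : R, 0 < eps -> \forall n \near \oo,
         exists2 E : {set 'I_n * 'I_n}, oriented E &
           t_density R E + i_density R E <= 1 / 9 + eps)].
Proof.
have lower (eps : R) : 0 < eps -> \forall n \near \oo,
    forall E : {set 'I_n * 'I_n}, oriented E ->
    1 / 9 - eps <= t_density R E + i_density R E.
  move=> eps_gt0; near=> n => E oE.
  apply: le_trans (density_lower R _ oE); last by near: n; exact: nbhs_infty_ge.
  rewrite lerB // ler_pdivrMr; last first.
    by rewrite ltr0n; near: n; exact: nbhs_infty_gt.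
  rewrite mulrC -ler_pdivrMr //; near: n; exact: nbhs_infty_ger.
split=> //; last first.
  move=> eps eps_gt0; near=> n; exists (blowup n); first exact: oriented_blowup.
  by rewrite (le_trans (blowup_density R n)) // lerDl ltW.
(* As [tau R n] never exceeds 1/9, only the lower bound, taken at a minimizer, limits the
   distance. *)
apply/cvgrPdist_le => eps eps_gt0; have := lower eps eps_gt0.
apply: filterS => n low; have [E oE tauE] := tau_attained R n.
have upper := le_trans (tau_le R (oriented_blowup n)) (blowup_density R n).
by rewrite ger0_norm ?subr_ge0 // lerBlDl -lerBlDr tauE low.
Unshelve. all: by end_near.
Qed.
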